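(* Let $(L,\sqsupseteq,\ast,e,\multimap)$ be a lineale. The category $\mathsf{M}_L\mathsf{Set}$ has products and coproducts, given by the operations $A \mathbin{\&} B$ and $A\oplus B$ respectively, and it is a symmetric monoidal closed category with monoidal product $\otimes$ and internal-hom $[-,-]$, where $\mathbin{\&}$, $\oplus$, $\otimes$ and $[-,-]$ are the operations defined in the context.
   Context: A partially ordered commutative monoid $(L,\sqsupseteq,\ast,e)$ is a commutative monoid $(L,\ast,e)$ with a partial order $\sqsupseteq$ such that $a\sqsupseteq b$ and $a'\sqsupseteq b'$ imply $a\ast a'\sqsupseteq b\ast b'$. A lineale $(L,\sqsupseteq,\ast,e,\multimap)$ is a partially ordered commutative monoid with a binary operation $\multimap$ (internal-hom) such that for all $a,b,c\in L$: $b\ast c\sqsupseteq a \iff b\sqsupseteq c\multimap a$; and if $b\sqsupseteq a$ and $a'\sqsupseteq b'$ then $a\multimap a'\sqsupseteq b\multimap b'$. The category $\mathsf{M}_L\mathsf{Set}$: objects are triples $(U,X,\alpha)$ with $U,X$ sets and $\alpha:U\times X\to L$ a function. A morphism $(f,F):(U,X,\alpha)\to(V,Y,\beta)$ is a pair of functions $f:U\to V$, $F:Y\to X$ such that $\alpha(u,F(y))\sqsupseteq\beta(f(u),y)$ for all $u\in U$, $y\in Y$. Identities are $(\mathrm{id}_U,\mathrm{id}_X)$ and composition is $(g,G)\circ(f,F)=(g\circ f,F\circ G)$. For objects $A=(U,X,\alpha)$, $B=(V,Y,\beta)$ (with $X^V$ the set of functions $V\to X$, and $+$ disjoint union): $A\mathbin{\&}B=(U\times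 V,\,X+Y,\,\alpha\mathbin{\&}\beta)$ with $(\alpha\mathbin{\&}\beta)(u,v,x)=\alpha(u,x)$ for $x\in X$ and $(\alpha\mathbin{\&}\beta)(u,v,y)=\beta(v,y)$ for $y\in Y$. $A\oplus B=(U+V,\,X\times Y,\,\alpha\oplus\beta)$ with $(\alpha\oplus\beta)(u,x,y)=\alpha(u,x)$ for $u\in U$ and $(\alpha\oplus\beta)(v,x,y)=\beta(v,y)$ for $v\in V$. $A\otimes B=(U\times V,\,X^V\times Y^U,\,\alpha\otimes\beta)$ with $(\alpha\otimes\beta)(u,v,f,g)=\alpha(u,f(v))\ast\beta(v,g(u))$. On morphisms $(f,F):(U,X,\alpha)\to(U',X',\alpha')$ and $(g,G):(V,Y,\beta)\to(V',Y',\beta')$, $(f,F)\otimes(g,G)=(f\times g,\;(\varphi,\psi)\mapsto(F\circ\varphi\circ g,\;G\circ\psi\circ f))$, the second component being a function $X'^{V'}\times Y'^{U'}\to X^V\times Y^U$. The monoidal unit is $(1,1,e)$, where $1$ is a one-element set and $e$ denotes the function with constant value $e$. $[A,B]=(V^U\times X^Y,\,U\times Y,\,[\alpha,\beta])$ with $[\alpha,\beta](f,F,u,y)=\alpha(u,F(y))\multimap\beta(f(u),y)$. *)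

(* Defs.v *)
From Stdlib Require Import Relation_Definitions ProofIrrelevance.

Set Implicit Arguments.
Unset Strict Implicit.
Unset Printing Implicit Defensive.

(* Categories: morphisms are compared by Leibniz equality. *)

Record category := Category {
  obj :> Type;
  hom : obj -> obj -> Type;
  idm : forall A, hom A A;
  comp : forall A B C, hom B C -> hom A B -> hom A C;
  comp_idl : forall A B (f : hom A B), comp (idm B) f = f;
  comp_idr : forall A B (f : hom A B), comp f (idm A) = f;
  comp_assoc : forall A B C D (h : hom C D) (g : hom B C) (f : hom A B),
    comp h (comp g f) = comp (comp h g) f
}.

Arguments hom {c} A B.
Arguments idm {c} A.
Arguments comp {c A B C} g f.

Notation "g ∘ f" := (comp g f) (at level 40, left associativity).

Section CategoryNotions.
Variable C : category.

Definition is_iso (A B : C) (f : hom A B) : Prop :=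
  exists g : hom B A, g ∘ f = idm A /\ f ∘ g = idm B.

Definition is_product (A B P : C) : Prop :=
  exists (p1 : hom P A) (p2 : hom P B),
    forall (Z : C) (f : hom Z A) (g : hom Z B),
      exists! h : hom Z P, p1 ∘ h = f /\ p2 ∘ h = g.

Definition is_coproduct (A B S : C) : Prop :=
  exists (i1 : hom A S) (i2 : hom B S),
    forall (Z : C) (f : hom A Z) (g : hom B Z),
      exists! h : hom S Z, h ∘ i1 = f /\ h ∘ i2 = g.

Variable T : C -> C -> C.
Variable Tmap : forall A A' B B' : C,
  hom A A' -> hom B B' -> hom (T A B) (T A' B').

Local Notation "A ⊠ B" := (T A B) (at level 35, right associativity).
Local Notation "f # g" := (Tmap f g) (at level 35, right associativity).

(* The symmetric monoidal structures whose tensor product is [T] on objects and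
   [Tmap] on morphisms, with unit [I]. *)
Record symmetric_monoidal (I : C) := SymmetricMonoidal {
  tensor_id : forall A B : C, idm A # idm B = idm (A ⊠ B);
  tensor_comp : forall (A A' A'' B B' B'' : C)
      (f' : hom A' A'') (f : hom A A') (g' : hom B' B'') (g : hom B B'),
    (f' ∘ f) # (g' ∘ g) = (f' # g') ∘ (f # g);

  associator : forall A B D : C, hom ((A ⊠ B) ⊠ D) (A ⊠ (B ⊠ D));
  left_unitor : forall A : C, hom (I ⊠ A) A;
  right_unitor : forall A : C, hom (A ⊠ I) A;
  braiding : forall A B : C, hom (A ⊠ B) (B ⊠ A);

  associator_iso : forall A B D : C, is_iso (associator A B D);
  left_unitor_iso : forall A : C, is_iso (left_unitor A);
  right_unitor_iso : forall A : C, is_iso (right_unitor A);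

  associator_natural : forall (A A' B B' D D' : C)
      (f : hom A A') (g : hom B B') (h : hom D D'),
    associator A' B' D' ∘ ((f # g) # h) = (f # (g # h)) ∘ associator A B D;
  left_unitor_natural : forall (A A' : C) (f : hom A A'),
    left_unitor A' ∘ (idm I # f) = f ∘ left_unitor A;
  right_unitor_natural : forall (A A' : C) (f : hom A A'),
    right_unitor A' ∘ (f # idm I) = f ∘ right_unitor A;
  braiding_natural : forall (A A' B B' : C) (f : hom A A') (g : hom B B'),
    braiding A' B' ∘ (f # g) = (g # f) ∘ braiding A B;

  pentagon : forall A B D E : C,
    associator A B (D ⊠ E) ∘ associator (A ⊠ B) D E
    = (idm A # associator B D E) ∘ associator A (B ⊠ D) E
        ∘ (associator A B D # idm E);
  triangle : forall A B : C,
    (idm A # left_unitor B) ∘ associator A I B = right_unitor A # idm B;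
  hexagon : forall A B D : C,
    associator B D A ∘ braiding A (B ⊠ D) ∘ associator A B D
    = (idm B # braiding A D) ∘ associator B A D ∘ (braiding A B # idm D);
  symmetry : forall A B : C, braiding B A ∘ braiding A B = idm (A ⊠ B)
}.

(* The closed structures for [T] whose internal hom is [H] on objects: [H]
   extends to a functor C^op x C -> C (contravariant in its first argument), and
   Hom(A ⊠ B, D) = Hom(A, H B D) naturally in A, B and D. *)
Record closed (H : C -> C -> C) := Closed {
  ihom_map : forall A A' B B' : C,
    hom A' A -> hom B B' -> hom (H A B) (H A' B');
  ihom_id : forall A B : C, ihom_map (idm A) (idm B) = idm (H A B);
  ihom_comp : forall (A A' A'' B B' B'' : C)
      (f : hom A' A) (f' : hom A'' A') (g' : hom B' B'') (g : hom B B'),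
    ihom_map (f ∘ f') (g' ∘ g) = ihom_map f' g' ∘ ihom_map f g;

  curry : forall A B D : C, hom (A ⊠ B) D -> hom A (H B D);
  uncurry : forall A B D : C, hom A (H B D) -> hom (A ⊠ B) D;
  curryK : forall (A B D : C) (k : hom (A ⊠ B) D), uncurry (curry k) = k;
  uncurryK : forall (A B D : C) (k : hom A (H B D)), curry (uncurry k) = k;
  curry_natural : forall (A A' B B' D D' : C)
      (f : hom A' A) (g : hom B' B) (h : hom D D') (k : hom (A ⊠ B) D),
    curry (h ∘ k ∘ (f # g)) = ihom_map g h ∘ curry k ∘ f
}.

End CategoryNotions.

Record pocmonoid := PoCMonoid {
  carrier :> Type;
  geq : carrier -> carrier -> Prop;
  mul : carrier -> carrier -> carrier;
  one : carrier;
  geq_order : order carrier geq;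
  mul_assoc : forall a b c, mul a (mul b c) = mul (mul a b) c;
  mul_comm : forall a b, mul a b = mul b a;
  mul_1l : forall a, mul one a = a;
  mul_mono : forall a b a' b', geq a b -> geq a' b' -> geq (mul a a') (mul b b')
}.

Arguments geq {p} a b.
Arguments mul {p} a b.
Arguments one {p}.

Notation "a ⊒ b" := (geq a b) (at level 70, no associativity).
Notation "a ∗ b" := (mul a b) (at level 40, left associativity).

Record lineale := Lineale {
  lineale_monoid :> pocmonoid;
  imp : lineale_monoid -> lineale_monoid -> lineale_monoid;
  imp_adj : forall a b c : lineale_monoid, b ∗ c ⊒ a <-> b ⊒ imp c a;
  imp_mono : forall a b a' b' : lineale_monoid,
    b ⊒ a -> a' ⊒ b' -> imp a a' ⊒ imp b b'
}.

Arguments imp {l} a b.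

Notation "a ⊸ b" := (imp a b) (at level 55, right associativity).

Section MLSet.
Variable L : lineale.

(* [MLObj alpha] is the triple (U, X, alpha), with alpha curried. *)
Record mlobj := MLObj { pos : Type; neg : Type; val : pos -> neg -> L }.

Record mlmor (A B : mlobj) := MLMor {
  fwd : pos A -> pos B;
  bwd : neg B -> neg A;
  mlmorP : forall u y, val u (bwd y) ⊒ val (fwd u) y
}.

Lemma mlmor_eq (A B : mlobj) (m n : mlmor A B) :
  fwd m = fwd n -> bwd m = bwd n -> m = n.
Proof.
destruct m as [f F p], n as [g G q]; simpl; intros <- <-.
f_equal; apply proof_irrelevance.
Qed.

Definition mlid (A : mlobj) : mlmor A A :=
  MLMor (fwd := fun u => u) (bwd := fun x => x)
    (fun u x => ord_refl _ _ (geq_order L) (val u x)).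

Lemma mlcompP (A B D : mlobj) (n : mlmor B D) (m : mlmor A B) u z :
  val u (bwd m (bwd n z)) ⊒ val (fwd n (fwd m u)) z.
Proof.
exact (ord_trans _ _ (geq_order L) _ _ _ (mlmorP m u _) (mlmorP n _ z)).
Qed.

Definition mlcomp (A B D : mlobj) (n : mlmor B D) (m : mlmor A B) : mlmor A D :=
  MLMor (mlcompP n m).

Definition MLSet : category.
Proof.
refine (@Category mlobj mlmor mlid mlcomp _ _ _);
  intros; apply mlmor_eq; reflexivity.
Defined.

Definition with_obj (A B : MLSet) : MLSet :=
  @MLObj (pos A * pos B) (neg A + neg B)
    (fun w z => match z with
                | inl x => val (fst w) x
                | inr y => val (snd w) y
                end).

Definition oplus_obj (A B : MLSet) : MLSet :=
  @MLObj (pos A + pos B) (neg A * neg B)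
    (fun w z => match w with
                | inl u => val u (fst z)
                | inr v => val v (snd z)
                end).

Definition tensor_obj (A B : MLSet) : MLSet :=
  @MLObj (pos A * pos B) ((pos B -> neg A) * (pos A -> neg B))
    (fun w z => val (fst w) (fst z (snd w)) ∗ val (snd w) (snd z (fst w))).

Lemma tensor_morP (A A' B B' : MLSet) (m : hom A A') (n : hom B B')
    (w : pos A * pos B) (z : (pos B' -> neg A') * (pos A' -> neg B')) :
  val (m := tensor_obj A B) w
      (fun v => bwd m (fst z (fwd n v)), fun u => bwd n (snd z (fwd m u)))
  ⊒ val (m := tensor_obj A' B') (fwd m (fst w), fwd n (snd w)) z.
Proof. apply mul_mono; apply mlmorP. Qed.

Definition tensor_mor (A A' B B' : MLSet) (m : hom A A') (n : hom B B') :
    hom (tensor_obj A B) (tensor_obj A' B') :=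
  MLMor (A := tensor_obj A B) (B := tensor_obj A' B') (tensor_morP m n).

Definition unit_obj : MLSet := @MLObj unit unit (fun _ _ => one).

Definition ihom_obj (A B : MLSet) : MLSet :=
  @MLObj ((pos A -> pos B) * (neg B -> neg A)) (pos A * neg B)
    (fun w z => val (fst z) (snd w (snd z)) ⊸ val (fst w (fst z)) (snd z)).

End MLSet.

(* Main.v *)
(** The associator, the unitors and the braiding are the evident maps of sets on
    positive and negative components; their inequalities hold because the two
    values agree by the monoid laws of [L], and the coherence laws are
    extensional equalities of functions. For the closed structure, morphisms
    [A ⊗ B -> D] and [A -> [B, D]], with [D = (S, T, δ)], both amount to maps
    [U × V -> S], [V × T -> X] and [U × T -> Y] subject to one inequality for
    each [(u, v, t)], and [imp_adj] identifies these two inequalities. *)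

From Stdlib Require Import FunctionalExtensionality Relation_Definitions.
Require Import Defs.

Lemma geq_refl (M : pocmonoid) (a : M) : a ⊒ a.
Proof. exact (ord_refl _ _ (geq_order M) a). Qed.

Lemma geq_of_eq (M : pocmonoid) (a b : M) : a = b -> a ⊒ b.
Proof. intros ->; apply geq_refl. Qed.

Lemma mul_1r (M : pocmonoid) (a : M) : a ∗ one = a.
Proof. rewrite mul_comm; apply mul_1l. Qed.

(* [prod] and [unit] have no definitional eta rule, so bound variables are
   destructed and functions with pair values are destructed at their arguments. *)
Ltac ext_step :=
  match goal with
  | |- ?a = ?a => reflexivity
  | |- @eq (_ -> _) _ _ => apply functional_extensionality; intros ?
  | x : (_ * _)%type |- _ => destruct x
  | x : unit |- _ => destruct x
  | |- @eq unit ?a ?b => destruct a, b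
  | |- @eq (_ * _) (_, _) (_, _) => apply f_equal2
  | |- @eq (_ * _) _ (?f ?x) => destruct (f x)
  end; simpl in *.

Ltac mlext := intros; apply mlmor_eq; simpl in *; repeat ext_step.

Section Structure.
Variable L : lineale.
Implicit Types A B D : MLSet L.

Lemma with_product A B : is_product A B (with_obj A B).
Proof.
exists (MLMor (A := with_obj A B) (B := A) (fwd := fst) (bwd := inl)
          (fun w x => geq_refl L (val (fst w) x))).
exists (MLMor (A := with_obj A B) (B := B) (fwd := snd) (bwd := inr)
          (fun w y => geq_refl L (val (snd w) y))).
intros Z f g.
(* Negative components point backwards, so the mediating map pairs [f] and [g] forwards and splits
   on the sum backwards; each case is the inequality of [f] or of [g]. *)
assert (pairP : forall u (y : neg (with_obj A B)),
  val u (match y with inl x => bwd f x | inr y => bwd g y end)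
  ⊒ val (m := with_obj A B) (fwd f u, fwd g u) y)
  by (intros u [x|y]; apply mlmorP).
exists (MLMor pairP); split.
- split; apply mlmor_eq; reflexivity.
- intros h [<- <-]; apply mlmor_eq; simpl; apply functional_extensionality.
  + intros u; symmetry; apply surjective_pairing.
  + intros [x|y]; reflexivity.
Qed.

Lemma oplus_coproduct A B : is_coproduct A B (oplus_obj A B).
Proof.
exists (MLMor (A := A) (B := oplus_obj A B) (fwd := inl) (bwd := fst)
          (fun u z => geq_refl L (val u (fst z)))).
exists (MLMor (A := B) (B := oplus_obj A B) (fwd := inr) (bwd := snd)
          (fun v z => geq_refl L (val v (snd z)))).
intros Z f g.
assert (copairP : forall (w : pos (oplus_obj A B)) z,
  val (m := oplus_obj A B) w (bwd f z, bwd g z)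
  ⊒ val (match w with inl u => fwd f u | inr v => fwd g v end) z)
  by (intros [u|v] z; apply mlmorP).
exists (MLMor copairP); split.
- split; apply mlmor_eq; reflexivity.
(* With [f] and [g] replaced by the composites with [h], uniqueness is case analysis on the sum and
   surjective pairing. *)
- intros h [<- <-]; apply mlmor_eq; simpl; apply functional_extensionality.
  + intros [u|v]; reflexivity.
  + intros z; symmetry; apply surjective_pairing.
Qed.

(** For positive sets [U], [V], [W] and negative sets [X], [Y], [Z], both negative sets are X^(V×W)
    × Y^(U×W) × Z^(U×V) up to currying. The term stays transparent so that the coherence laws can be
    checked by computation. *)
Definition assoc_mor A B D :
  hom (tensor_obj (tensor_obj A B) D) (tensor_obj A (tensor_obj B D)).
Proof.
refine (MLMor (A := tensor_obj (tensor_obj A B) D)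
  (B := tensor_obj A (tensor_obj B D))
  (fwd := fun w => (fst (fst w), (snd (fst w), snd w)))
  (bwd := fun z =>
    (fun w => (fun v => fst z (v, w), fun u => fst (snd z u) w),
     fun uv => snd (snd z (fst uv)) (snd uv))) _).
intros; apply geq_of_eq; symmetry; apply mul_assoc.
Defined.

Definition assoc_inv A B D :
  hom (tensor_obj A (tensor_obj B D)) (tensor_obj (tensor_obj A B) D).
Proof.
refine (MLMor (A := tensor_obj A (tensor_obj B D))
  (B := tensor_obj (tensor_obj A B) D)
  (fwd := fun w => ((fst w, fst (snd w)), snd (snd w)))
  (bwd := fun z =>
    (fun vw => fst (fst z (snd vw)) (fst vw),
     fun u => (fun w => snd (fst z w) u, fun v => snd z (u, v)))) _).
intros; apply geq_of_eq, mul_assoc.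
Defined.

(** The negative set of the source is 1^U × X^1, a copy of [X]. *)
Definition lunit_mor A : hom (tensor_obj (unit_obj L) A) A.
Proof.
refine (MLMor (A := tensor_obj (unit_obj L) A) (B := A)
  (fwd := snd) (bwd := fun x => (fun _ => tt, fun _ => x)) _).
intros; apply geq_of_eq, mul_1l.
Defined.

Definition lunit_inv A : hom A (tensor_obj (unit_obj L) A).
Proof.
refine (MLMor (A := A) (B := tensor_obj (unit_obj L) A)
  (fwd := fun u => (tt, u)) (bwd := fun z => snd z tt) _).
intros; apply geq_of_eq; symmetry; apply mul_1l.
Defined.

Definition runit_mor A : hom (tensor_obj A (unit_obj L)) A.
Proof.
refine (MLMor (A := tensor_obj A (unit_obj L)) (B := A)
  (fwd := fst) (bwd := fun x => (fun _ => x, fun _ => tt)) _).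
intros; apply geq_of_eq, mul_1r.
Defined.

Definition runit_inv A : hom A (tensor_obj A (unit_obj L)).
Proof.
refine (MLMor (A := A) (B := tensor_obj A (unit_obj L))
  (fwd := fun u => (u, tt)) (bwd := fun z => fst z tt) _).
intros; apply geq_of_eq; symmetry; apply mul_1r.
Defined.

Definition braid_mor A B : hom (tensor_obj A B) (tensor_obj B A).
Proof.
refine (MLMor (A := tensor_obj A B) (B := tensor_obj B A)
  (fwd := fun w => (snd w, fst w)) (bwd := fun z => (snd z, fst z)) _).
intros; apply geq_of_eq, mul_comm.
Defined.

Definition MLSet_symmetric_monoidal :
  symmetric_monoidal (@tensor_mor L) (unit_obj L).
Proof.
refine (@SymmetricMonoidal (MLSet L) (@tensor_obj L) (@tensor_mor L) (unit_obj L)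
  _ _ assoc_mor lunit_mor runit_mor braid_mor _ _ _ _ _ _ _ _ _ _ _).
(* Functoriality, naturality and coherence are equations between morphisms and close here; the
   invertibility goals remain, each needing an explicit inverse. *)
all: try solve [mlext].
- intros A B D; exists (assoc_inv A B D); split; mlext.
- intros A; exists (lunit_inv A); split; mlext.
- intros A; exists (runit_inv A); split; mlext.
Defined.

Definition ihom_mor A A' B B' (f : hom A' A) (g : hom B B') :
  hom (ihom_obj A B) (ihom_obj A' B').
Proof.
refine (MLMor (A := ihom_obj A B) (B := ihom_obj A' B')
  (fwd := fun w => (fun u => fwd g (fst w (fwd f u)),
                    fun y => bwd f (snd w (bwd g y))))
  (bwd := fun z => (fwd f (fst z), bwd g (snd z))) _).
(* [⊸] is antitone on the left, where [f] acts, and monotone on the right, where [g] acts. *)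
intros; apply imp_mono; apply mlmorP.
Defined.

(** The backward map of [k] has two halves: the one into Y^U joins the forward map, and the one into
    X^V, uncurried, becomes the new backward map. *)
Definition curry_mor A B D (k : hom (tensor_obj A B) D) : hom A (ihom_obj B D).
Proof.
refine (MLMor (A := A) (B := ihom_obj B D)
  (fwd := fun u => (fun v => fwd k (u, v), fun t => snd (bwd k t) u))
  (bwd := fun z => fst (bwd k (snd z)) (fst z)) _).
intros u [v t]; apply imp_adj; exact (mlmorP k (u, v) t).
Defined.

Definition uncurry_mor A B D (k : hom A (ihom_obj B D)) : hom (tensor_obj A B) D.
Proof.
refine (MLMor (A := tensor_obj A B) (B := D)
  (fwd := fun w => fst (fwd k (fst w)) (snd w))
  (bwd := fun t => (fun v => bwd k (v, t), fun u => snd (fwd k u) t)) _).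
intros [u v] t; apply imp_adj; exact (mlmorP k u (v, t)).
Defined.

Definition MLSet_closed : closed (@tensor_mor L) (@ihom_obj L).
Proof.
refine (@Closed (MLSet L) (@tensor_obj L) (@tensor_mor L) (@ihom_obj L)
  ihom_mor _ _ curry_mor uncurry_mor _ _ _).
all: mlext.
Defined.

End Structure.

Theorem theorem3p12 (L : lineale) :
  (forall A B : MLSet L, is_product A B (with_obj A B)) /\
  (forall A B : MLSet L, is_coproduct A B (oplus_obj A B)) /\
  inhabited (symmetric_monoidal (C := MLSet L) (T := @tensor_obj L)
               (@tensor_mor L) (unit_obj L)) /\
  inhabited (closed (C := MLSet L) (T := @tensor_obj L)
               (@tensor_mor L) (@ihom_obj L)).
Proof.
split; [|split; [|split]].
- apply with_product.
- apply oplus_coproduct.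
- exact (inhabits (MLSet_symmetric_monoidal L)).
- exact (inhabits (MLSet_closed L)).
Qed.
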